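(* Let $(A,\|\cdot\|)$ be any non-unital normed algebra. Then: (1) $\overline{co}(V_A(a)\cup\{0\})\subset V_{A_e^1}(a;1)$ for all $a\in A$; (2) $\frac1e\|a+\lambda 1\|_1\le\nu_{A_e^1}(a+\lambda 1;1)\le\|a+\lambda 1\|_1$ for all $a+\lambda 1\in A_e$; (3) $\frac1e\|a\|\le\nu_{A_e^1}(a;1)\le\|a\|$ for all $a\in A$.
   Context: A normed algebra $(A,\|\cdot\|)$ is a complex associative algebra with a submultiplicative norm; it is not assumed to be complete or unital. Non-unital means having no (two-sided) identity element. $A_e=A+\mathbb{C}1$ is the unitization of $A$, with adjoined identity $1$. The $\ell^1$-norm on $A_e$ is $\|a+\lambda 1\|_1=\|a\|+|\lambda|$, and $A_e^1=(A_e,\|\cdot\|_1)$. For any normed algebra $B$: $S(B)=\{x\in B:\|x\|=1\}$; $B^*$ is its Banach space dual; $D_B(x)=\{\varphi\in B^*:\|\varphi\|=1=\varphi(x)\}$ for $x\in S(B)$; $V_B(b;x)=\{\varphi(bx):\varphi\in D_B(x)\}$ for $b\in B$, $x\in S(B)$; the spatial numerical range of $b$ is $V_B(b)=\bigcup\{V_B(b;x):x\in S(B)\}$; and $\nu_B(b;x)=\sup\{|\lambda|:\lambda\in V_B(b;x)\}$. For $K\subset\mathbb{C}$, $\overline{co}(K)$ is the closed convex hull of $K$. Here $e$ in $\frac1e$ is Euler's number. *)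

(* Defs.v *)
From HB Require Import structures.
From mathcomp Require Import all_boot all_order all_algebra.
From mathcomp Require Import complex.
From mathcomp Require Import all_classical all_reals all_analysis.

Set Implicit Arguments.
Unset Strict Implicit.
Unset Printing Implicit Defensive.

Import Order.TTheory GRing.Theory Num.Theory.
Import numFieldNormedType.Exports.

Local Open Scope classical_set_scope.
Local Open Scope complex_scope.
Local Open Scope ring_scope.

(* The ring structures of MathComp all have an identity, so the product of a
   possibly non-unital algebra is a separate operation [amul]. The scalars are
   R[i], and the norm of a normedModType R[i] is R[i]-valued with nonnegative
   real values. *)
HB.mixin Record NormedModule_isNormedAlgebra (R : realType) A
    & NormedModule R[i] A := {
  amul : A -> A -> A;
  amulA : forall x y z, amul x (amul y z) = amul (amul x y) z;
  amulDl : forall x y z, amul (x + y) z = amul x z + amul y z;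
  amulDr : forall x y z, amul x (y + z) = amul x y + amul x z;
  amulZl : forall (k : R[i]) x y, amul (k *: x) y = k *: amul x y;
  amulZr : forall (k : R[i]) x y, amul x (k *: y) = k *: amul x y;
  ler_norm_amul : forall x y, `|amul x y| <= `|x| * `|y|
}.

#[short(type="normedAlgType")]
HB.structure Definition NormedAlgebra (R : realType) :=
  {A of NormedModule R[i] A & NormedModule_isNormedAlgebra R A}.

Definition non_unital (R : realType) (A : normedAlgType R) : Prop :=
  ~ exists e : A, forall x : A, amul e x = x /\ amul x e = x.

Section numerical_range.
Context {R : realType} {B : normedAlgType R}.
Implicit Types (b x : B) (phi : {linear B -> R[i]^o}).

Definition unit_sphere : set B := [set x | `|x| = 1].

Definition dual : set {linear B -> R[i]^o} :=
  [set phi | continuous (phi : B -> R[i]^o)].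

Definition dual_norm phi : R :=
  sup [set Normc.normc (phi x) | x in [set x : B | `|x| <= 1]].

Definition support_functionals x : set {linear B -> R[i]^o} :=
  [set phi | [/\ dual phi, dual_norm phi = 1 & phi x = 1]].

Definition numrange_at b x : set R[i]^o :=
  [set phi (amul b x) | phi in support_functionals x].

Definition numrange b : set R[i]^o :=
  \bigcup_(x in unit_sphere) numrange_at b x.

Definition numradius_at b x : R :=
  sup [set Normc.normc z | z in numrange_at b x].

End numerical_range.

(* The weights in [convex_set] satisfy 0 <= t <= 1 for the order of R[i],
   under which comparable numbers have the same imaginary part; hence t is
   real and this is ordinary convexity in the complex plane. *)
Definition closed_convex_hull (R : realType) (K : set R[i]^o) : set R[i]^o :=
  smallest [set D : set R[i]^o | closed D /\ convex_set D] K.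

(* [unitization A] is A_e with the l1-norm; the pair (a, l) stands for
   a + l 1. *)
Definition unitization (R : realType) (A : normedAlgType R) : Type :=
  (A * R[i]^o)%type.

Section unitization.
Context {R : realType} {A : normedAlgType R}.
Local Notation Ae := (unitization A).

HB.instance Definition _ := GRing.Lmodule.copy Ae (A * R[i]^o)%type.

Definition unitization_norm (u : Ae) : R[i] := `|u.1| + `|u.2|.

Definition unitization_mul (u v : Ae) : Ae :=
  (amul u.1 v.1 + v.2 *: u.1 + u.2 *: v.1, u.2 * v.2).

Fact unitization_ler_normD (u v : Ae) :
  unitization_norm (u + v) <= unitization_norm u + unitization_norm v.
Proof. by rewrite /unitization_norm addrACA lerD ?ler_normD. Qed.

Fact unitization_normrZ (k : R[i]) (u : Ae) :
  unitization_norm (k *: u) = `|k| * unitization_norm u.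
Proof. by rewrite /unitization_norm !normrZ mulrDr. Qed.

Fact unitization_normr0_eq0 (u : Ae) : unitization_norm u = 0 -> u = 0.
Proof.
move=> /eqP; rewrite paddr_eq0// !normr_eq0 => /andP[/eqP u1 /eqP u2].
by case: u u1 u2 => a l /= -> ->.
Qed.

HB.instance Definition _ := Lmodule_isNormed.Build R[i] Ae
  unitization_ler_normD unitization_normrZ unitization_normr0_eq0.

Fact unitization_mulDl (u v w : Ae) :
  unitization_mul (u + v) w = unitization_mul u w + unitization_mul v w.
Proof.
apply: (congr2 pair) => /=; last by rewrite mulrDl.
by rewrite amulDl scalerDr scalerDl [RHS]addrACA [in RHS](addrACA (amul _ _)).
Qed.

Fact unitization_mulDr (u v w : Ae) :
  unitization_mul u (v + w) = unitization_mul u v + unitization_mul u w.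
Proof.
apply: (congr2 pair) => /=; last by rewrite mulrDr.
by rewrite amulDr scalerDr scalerDl [RHS]addrACA [in RHS](addrACA (amul _ _)).
Qed.

Fact unitization_mulZl (k : R[i]) (u v : Ae) :
  unitization_mul (k *: u) v = k *: unitization_mul u v.
Proof.
apply: (congr2 pair) => /=; last by rewrite -mulrA.
by rewrite amulZl !scalerDr !scalerA [v.2 * k]mulrC.
Qed.

Fact unitization_mulZr (k : R[i]) (u v : Ae) :
  unitization_mul u (k *: v) = k *: unitization_mul u v.
Proof.
apply: (congr2 pair) => /=; last by rewrite mulrCA.
by rewrite amulZr !scalerDr !scalerA [u.2 * k]mulrC.
Qed.

Fact unitization_mulA (u v w : Ae) :
  unitization_mul u (unitization_mul v w) =
  unitization_mul (unitization_mul u v) w.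
Proof.
apply: (congr2 pair) => /=; last by rewrite mulrA.
rewrite !(amulDl, amulDr, amulZl, amulZr, scalerDr, scalerA, amulA) !addrA.
rewrite [w.2 * v.2]mulrC [w.2 * u.2]mulrC.
by rewrite [LHS](ACl (1 * 3 * 5 * 2 * 4 * 6 * 7)%AC).
Qed.

Fact unitization_ler_norm_mul (u v : Ae) :
  `|unitization_mul u v| <= `|u| * `|v|.
Proof.
rewrite [leLHS]/(unitization_norm _) [X in X * _]/(unitization_norm _).
rewrite [X in _ * X]/(unitization_norm _) /unitization_norm /=.
rewrite normrM mulrDr !mulrDl [leRHS]addrA lerD2r.
apply: (le_trans (ler_normD _ _)).
rewrite -[leRHS]addrA [X in _ <= _ + X]addrC [leRHS]addrA.
rewrite normrZ lerD//; apply: (le_trans (ler_normD _ _)).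
by rewrite normrZ [`|v.2| * _]mulrC lerD// ler_norm_amul.
Qed.

HB.instance Definition _ := NormedModule_isNormedAlgebra.Build R Ae
  unitization_mulA unitization_mulDl unitization_mulDr
  unitization_mulZl unitization_mulZr unitization_ler_norm_mul.

Definition adjoin (a : A) (l : R[i]) : Ae := (a, l).

Definition adjoined_one : Ae := adjoin 0 1.

End unitization.

(* Main.v *)
(* Since the identity splits off as an l1-summand, the states of A_e^1 at 1 are
   the functionals a + l 1 |-> phi a + l with phi any functional on A of norm at
   most 1. By the Hahn-Banach theorem V_{A_e^1}(a + l 1; 1) is therefore the
   whole closed disk of centre l and radius |a|, so the numerical radius equals
   the norm, and the disk for l = 0 is a closed convex set containing 0 and
   V_A(a). *)
Require Import Defs.
From HB Require Import structures.
From mathcomp Require Import all_boot all_order all_algebra.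
From mathcomp Require Import complex.
From mathcomp Require Import all_classical all_reals all_analysis.

Import Order.TTheory GRing.Theory Num.Theory.
Import numFieldNormedType.Exports.

Local Open Scope classical_set_scope.
Local Open Scope complex_scope.
Local Open Scope ring_scope.

(** * Real Hahn-Banach theorem through minimal sublinear functionals *)

Section hahn_banach.
Context {R : realType} {V : lmodType R}.
Implicit Types (p q : V -> R) (x y : V).

(** Homogeneity is asked only as an inequality for positive scalars, which passes easily to infima;
    applying it to [r^-1] recovers equality. *)
Definition sublinear q : Prop :=
  (forall x y, q (x + y) <= q x + q y) /\
  (forall (r : R) x, 0 < r -> q (r *: x) <= r * q x).

Lemma sublinearZ q (r : R) x : sublinear q -> 0 < r -> q (r *: x) = r * q x.
Proof.
move=> [_ qZ] r0; apply/eqP; rewrite eq_le qZ//=.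
have := qZ r^-1 (r *: x); rewrite invr_gt0 scalerA mulVf ?gt_eqF// scale1r.
by move=> /(_ r0); rewrite ler_pdivlMl.
Qed.

Lemma sublinear0 q : sublinear q -> q 0 = 0.
Proof.
move=> sq; have := sublinearZ q 2 0 sq (ltr0Sn _ 1).
by rewrite scaler0 mulr_natl mulr2n => /eqP; rewrite -subr_eq subrr => /eqP.
Qed.

Lemma sublinear_geN q x : sublinear q -> - q (- x) <= q x.
Proof.
move=> sq; rewrite lerNl -subr_ge0 opprK addrC -(sublinear0 q sq) -(subrr x).
exact: sq.1.
Qed.

(* The directedness hypotheses cover both a chain of sublinear functionals and
   the family [x |-> q (x + t *: y) - t * q y], whose members are not sublinear
   individually. *)
Lemma sublinear_inf {I : Type} (D : set I) (f : I -> V -> R) (l : V -> R) :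
    D !=set0 ->
    (forall i x, D i -> l x <= f i x) ->
    (forall i j x y, D i -> D j ->
      exists2 k, D k & f k (x + y) <= f i x + f j y) ->
    (forall i (r : R) x, D i -> 0 < r ->
      exists2 k, D k & f k (r *: x) <= r * f i x) ->
  sublinear (fun x => inf [set f i x | i in D]).
Proof.
move=> [i0 Di0] lf fD fZ.
have infle x i : D i -> inf [set f i x | i in D] <= f i x.
  move=> Di; apply: ge_inf; last by exists i.
  by exists (l x) => _ [j Dj <-]; exact: lf.
have leinf x c : (forall i, D i -> c <= f i x) -> c <= inf [set f i x | i in D].
  move=> cf; apply: lb_le_inf; first by exists (f i0 x), i0.
  by move=> _ [j Dj <-]; exact: cf.
split=> [x y|r x r0].
  rewrite -lerBlDr; apply: (leinf) => i Di.
  rewrite lerBlDr -lerBlDl; apply: (leinf) => j Dj; rewrite lerBlDl.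
  by have [k Dk fk] := fD _ _ x y Di Dj; exact: le_trans (infle _ _ Dk) fk.
rewrite -ler_pdivrMl//; apply: (leinf) => i Di; rewrite ler_pdivrMl//.
by have [k Dk fk] := fZ _ _ x Di r0; exact: le_trans (infle _ _ Dk) fk.
Qed.

(** Subadditivity at [(x + t *: y) + (- x)] gives a bound free of [t], so the infimum over [t] taken
    next is finite. *)
Lemma sublinear_tilt_lb q x y (t : R) : sublinear q -> 0 <= t ->
  - q (- x) <= q (x + t *: y) - t * q y.
Proof.
move=> sq; rewrite le_eqVlt => /predU1P[<-|t0].
  by rewrite scale0r mul0r addr0 subr0 sublinear_geN.
rewrite lerBrDr addrC lerBlDr -sublinearZ//.
by have := sq.1 (x + t *: y) (- x); rewrite addrAC subrr add0r.
Qed.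

(** The classical auxiliary functional: for sublinear [q], a linear [f] below [tilt q y] lies below
    [q] and satisfies [f y = q y]. *)
Definition tilt q y x : R :=
  inf [set q (x + t *: y) - t * q y | t in [set t : R | 0 <= t]].

Lemma tilt_le q y x (t : R) : sublinear q -> 0 <= t ->
  tilt q y x <= q (x + t *: y) - t * q y.
Proof.
move=> sq t0; apply: ge_inf; last by exists t.
by exists (- q (- x)) => _ [s s0 <-]; exact: sublinear_tilt_lb.
Qed.

Lemma tilt_le_id q y x : sublinear q -> tilt q y x <= q x.
Proof.
move=> sq; have := tilt_le q y x 0 sq (lexx _).
by rewrite scale0r mul0r addr0 subr0.
Qed.

Lemma sublinear_tilt q y : sublinear q -> sublinear (tilt q y).
Proof.
move=> sq; apply: (sublinear_inf _ _ (fun x => - q (- x))).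
- by exists 0 => /=.
- by move=> t x t0; exact: sublinear_tilt_lb.
(* The parameters of two summands add up; scaling by [r] turns [t] into [r * t]. *)
- move=> s t x x' /= s0 t0; exists (s + t); first exact: addr_ge0.
  rewrite addrACA -opprD -mulrDl lerB// scalerDl addrACA; exact: sq.1.
- move=> t r x /= t0 r0; exists (r * t); first by rewrite mulr_ge0// ltW.
  by rewrite -scalerA -scalerDr sublinearZ// mulrBr mulrA.
Qed.

(** Zorn's lemma on the sublinear functionals below [p]: a nonempty chain is bounded below by its
    pointwise infimum, finite because every member is at least [- p (- x)] at [x]. *)
Lemma exists_minimal_sublinear p : sublinear p ->
  exists q, [/\ sublinear q, forall x, q x <= p x &
    forall q', sublinear q' ->
      (forall x, q' x <= q x) -> forall x, q x <= q' x].
Proof.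
move=> sp; pose T := {q : V -> R | sublinear q /\ forall x, q x <= p x}.
(* The order is reversed, so that a maximal element is a minimal functional. *)
pose ge (q q' : T) := `[< forall x, sval q' x <= sval q x >].
have p0 : T by exists p.
have [|||q qmin] := @ZL_preorder T p0 ge.
- by move=> q; apply/asboolP.
- move=> q r s /asboolP rq /asboolP qs; apply/asboolP => x.
  exact: le_trans (qs x) (rq x).
- move=> C totC; have [[q0 Cq0]|C0] := pselect (C !=set0); last first.
    by exists p0 => s Cs; case: C0; exists s.
  have lbC (q : T) x : - p (- x) <= sval q x.
    case: q => q [sq qp] /=; apply: le_trans (sublinear_geN q x sq).
    by rewrite lerN2.
  pose m x := inf [set sval q x | q in C].
  have mle (q : T) x : C q -> m x <= sval q x.
    by move=> Cq; apply: ge_inf; [exists (- p (- x)) => _ [r _ <-] |exists q].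
  have sm : sublinear m.
    apply: (sublinear_inf _ _ (fun x => - p (- x))); first by exists q0.
    - by move=> q x _; exact: lbC.
    - move=> q r x y Cq Cr.
      have [/asboolP qr|/asboolP rq] := totC _ _ Cq Cr.
        exists r => //; apply: le_trans ((svalP r).1.1 _ _) _.
        by rewrite lerD2r.
      exists q => //; apply: le_trans ((svalP q).1.1 _ _) _.
      by rewrite lerD2l.
    - by move=> q r x Cq r0; exists q => //; exact: (svalP q).1.2.
  have mp x : m x <= p x by apply: le_trans (mle _ x Cq0) ((svalP q0).2 x).
  by exists (exist _ m (conj sm mp)) => s Cs; apply/asboolP => x; exact: mle.
exists (sval q); split; [exact: (svalP q).1|exact: (svalP q).2|].
move=> q' sq' q'q; have q'p x : q' x <= p x.
  exact: le_trans (q'q x) ((svalP q).2 x).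
by have /asboolP := qmin (exist _ q' (conj sq' q'p)) (introT (asboolP _) q'q).
Qed.

(* A minimal sublinear functional equals its own tilts, hence is additive. *)
Lemma exists_linear_le p : sublinear p ->
  exists f : {linear V -> R^o}, forall x, f x <= p x.
Proof.
move=> /exists_minimal_sublinear[q [sq qp qmin]].
have qD x y : q (x + y) = q x + q y.
  apply/eqP; rewrite eq_le sq.1/= -lerBrDr.
  (* Minimality gives [q x <= tilt q y x]; the parameter [t = 1] then yields
     [q x <= q (x + y) - q y]. *)
  have := qmin _ (sublinear_tilt q y sq) (fun x => tilt_le_id q y x sq) x.
  by move/le_trans => /(_ _ (tilt_le q y x 1 sq ler01)); rewrite scale1r mul1r.
have qN x : q (- x) = - q x.
  by apply/eqP; rewrite -addr_eq0 -qD addNr sublinear0.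
have qZ (r : R) x : q (r *: x) = r * q x.
  have [r0|r0|->] := ltgtP r 0; last by rewrite scale0r mul0r sublinear0.
  - by rewrite -[r in LHS]opprK scaleNr qN sublinearZ ?oppr_gt0// mulNr opprK.
  - exact: sublinearZ.
have q_linear : linear (q : V -> R^o) by move=> r x y; rewrite qD qZ.
pose f : {linear V -> R^o} :=
  HB.pack (q : V -> R^o) (GRing.isLinear.Build R V R^o *:%R q q_linear).
by exists f.
Qed.

(** Domination by [tilt p a] instead of [p] forces equality at [a]: the parameter [t = 1] at [- a]
    gives [f (- a) <= - p a]. *)
Lemma hahn_banach p (a : V) : sublinear p ->
  exists2 f : {linear V -> R^o}, (forall x, f x <= p x) & f a = p a.
Proof.
move=> sp; have [f fp] := exists_linear_le _ (sublinear_tilt p a sp).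
exists f => [x|]; first exact: le_trans (fp x) (tilt_le_id p a x sp).
apply/eqP; rewrite eq_le (le_trans (fp a) (tilt_le_id p a a sp))/=.
have := le_trans (fp (- a)) (tilt_le p a (- a) 1 sp ler01).
by rewrite raddfN/= scale1r mul1r addNr sublinear0// sub0r lerN2.
Qed.

End hahn_banach.

(** * Restriction of scalars, on an alias that keeps the two module structures apart *)

Definition real_scalars {R : realType} (V : lmodType R[i]) : Type := V.

Section real_scalars.
Context {R : realType} {V : lmodType R[i]}.
Local Notation VR := (real_scalars V).

HB.instance Definition _ := GRing.Zmodule.on VR.

Definition real_scale (r : R) (x : VR) : VR := (r%:C *: (x : V) : V).

Fact real_scaleA (r s : R) (x : VR) :
  real_scale r (real_scale s x) = real_scale (r * s) x.
Proof. by rewrite /real_scale scalerA -rmorphM. Qed.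

Fact real_scale1 : left_id 1 real_scale.
Proof. by move=> x; rewrite /real_scale scale1r. Qed.

Fact real_scaleDr : right_distributive real_scale +%R.
Proof. by move=> r x y; rewrite /real_scale; exact: scalerDr. Qed.

Fact real_scaleDl (x : VR) :
  {morph (fun r => real_scale r x) : r s / r + s}.
Proof. by move=> r s; rewrite /real_scale rmorphD; exact: scalerDl. Qed.

HB.instance Definition _ := GRing.Zmodule_isLmodule.Build R VR
  real_scaleA real_scale1 real_scaleDr real_scaleDl.

End real_scalars.

(** * Complex norming functionals *)

Section norming_functional.
Context {R : realType} {V : normedModType R[i]}.
Implicit Types (x y a : V).

Definition rnorm x : R := complex.Re `|x|.

Lemma rnormE x : `|x| = (rnorm x)%:C.
Proof. by rewrite RRe_real// normr_real. Qed.

Lemma sublinear_rnorm : sublinear (rnorm : real_scalars V -> R).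
Proof.
split=> [x y|r x r0].
  by rewrite -lecR rmorphD/= -!rnormE; exact: (@ler_normD _ V).
rewrite -lecR rmorphM/= -!rnormE [X in `|X|]/(r%:C *: (x : V)) normrZ.
by rewrite ger0_norm// ler0c ltW.
Qed.

(* The complex functional with real part f is f x - i f (i x). *)
Lemma exists_norming_functional a :
  exists2 phi : {linear V -> R[i]^o},
    forall x, `|phi x| <= `|x| & phi a = `|a|.
Proof.
have [f f_le fa] := hahn_banach _ (a : real_scalars V) sublinear_rnorm.
have fZ (r : R) x : f (r%:C *: x) = r * f x.
  by exact: (linearZZ f r (x : real_scalars V)).
have fD x y : f ((x + y : V)) = f x + f y by exact: (raddfD f).
pose g x : R[i]^o := f x +i* - f ('i%C *: x).
have gD x y : g (x + y) = g x + g y by rewrite /g scalerDr !fD opprD.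
have gR (r : R) x : g (r%:C *: x) = r%:C * g x.
  rewrite /g scalerA mulrC -scalerA !fZ; apply/eqP; rewrite eq_complex/=.
  by rewrite !mul0r subr0 addr0 mulrN !eqxx.
have gi x : g ('i%C *: x) = 'i%C * g x.
  have fN y : f (- y : V) = - f y by exact: (raddfN f).
  rewrite /g scalerA -expr2 sqr_i scaleN1r fN opprK.
  apply/eqP; rewrite eq_complex/=.
  by rewrite !mul0r !mul1r sub0r add0r opprK !eqxx.
have g_linear : linear g.
  move=> c x y; rewrite gD [c]complexE scalerDl gD -scalerA gi !gR mulrA.
  by rewrite -mulrDl.
pose phi : {linear V -> R[i]^o} :=
  HB.pack g (GRing.isLinear.Build R[i] V R[i]^o *:%R g g_linear).
have phi_le x : `|phi x| <= `|x|.
  have [->|phix0] := eqVneq (phi x) 0; first by rewrite normr0.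
  (* The unimodular [c] rotates [phi x] onto its modulus, which is real, so the bound on the real
     part [f] bounds the modulus. *)
  pose c := `|phi x| / phi x.
  have c1 : `|c| = 1 by rewrite normf_div normr_id divff// normr_eq0.
  have phicx : phi (c *: x) = `|phi x| by rewrite linearZ; exact: divfK.
  have : complex.Re (phi (c *: x)) <= rnorm (c *: x) by exact: f_le.
  by rewrite -lecR -rnormE normrZ c1 mul1r phicx RRe_real// normr_real.
(* The real part of [phi a] is already the norm of [a], so the contraction bound leaves no room for
   an imaginary part. *)
exists phi => //; rewrite [RHS]rnormE -fa; apply/eqP; rewrite eq_complex eqxx/=.
have fa0 : 0 <= f a by rewrite fa -ler0c -rnormE.
have := phi_le a; rewrite rnormE -fa normc_def lecR -ler_sqr ?nnegrE//.
rewrite sqr_sqrtr ?addr_ge0 ?sqr_ge0//= gerDl => im_le0.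
by rewrite -sqrf_eq0 eq_le im_le0 sqr_ge0.
Qed.

End norming_functional.

(** * Closedness and convexity of disks *)

Section disk.
Context {R : realType} {V : normedModType R[i]}.

Lemma closed_disk (r : R[i]) : closed [set x : V | `|x| <= r].
Proof.
move=> x clx.
have approx (e : R[i]) : 0 < e -> exists2 y, `|y| <= r & `|x - y| < e.
  move=> e0; have /clx[y [yr xy]] : nbhs x (ball x e) by exact: nbhsx_ballx.
  by exists y => //; rewrite -ball_normE in xy.
have [y0 y0r _] := approx 1 ltr01.
(* The radius lives in [R[i]]; dominating the norm of [y0] makes it real, so the comparison can move
   to [R]. *)
have rE : r = (complex.Re r)%:C.
  by rewrite RRe_real// ger0_real//; exact: le_trans y0r.
rewrite /= rnormE rE lecR; apply/ler_addgt0Pr => e e0.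
have [|y yr xy] := approx e%:C; first by rewrite ltcR.
rewrite -lecR -rnormE rmorphD/= -rE -(subrK y x) addrC.
by apply: le_trans (ler_normD _ _) _; rewrite lerD// ltW.
Qed.

Lemma convex_disk (r : R[i]) : convex_set [set x : V | `|x| <= r].
Proof.
apply/convex_setW => x y; rewrite !inE /= => xr yr t t0 t1.
have onem_t0 : 0 <= 1 - t%:num by rewrite subr_ge0 ltW.
apply: mem_set; change (`|t%:num *: (x : V) + (1 - t%:num) *: (y : V)| <= r).
apply: le_trans (ler_normD _ _) _.
rewrite !normrZ (ger0_norm (ltW t0)) (ger0_norm onem_t0).
rewrite -[leRHS]mul1r -[X in X * r](subrK t%:num) [leRHS]mulrDl [leRHS]addrC.
by apply: lerD; apply: ler_wpM2l => //; exact: ltW.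
Qed.

End disk.

(** * Support functionals as contractions *)

Section support_functionals.
Context {R : realType} {B : normedAlgType R}.
Implicit Types (x y : B) (phi : {linear B -> R[i]^o}).

Lemma support_functional_le x phi y :
  support_functionals x phi -> `|phi y| <= `|y|.
Proof.
move=> [_ norm_phi _].
have ball_sup :
    has_sup [set Normc.normc (phi z) | z in [set z : B | `|z| <= 1]].
  (* A set without supremum has [sup] equal to 0 by default, which dual norm 1 excludes. *)
  apply: contrapT => /sup_out sup0; move: norm_phi; rewrite /dual_norm sup0.
  by move/esym/eqP; rewrite oner_eq0.
have [->|y0] := eqVneq y 0; first by rewrite linear0 !normr0.
have Ny : [set Normc.normc (phi z) | z in [set z : B | `|z| <= 1]]
    (Normc.normc (phi (`|y|^-1 *: y))).
  exists (`|y|^-1 *: y) => //=.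
  by rewrite normrZ normfV normr_id mulVf// normr_eq0.
have := sup_upper_bound ball_sup Ny.
rewrite -/(dual_norm phi) norm_phi -lecR -[leLHS]/(`|phi _|) linearZ normrZ.
by rewrite normfV normr_id ler_pdivrMl ?normr_gt0// mulr1.
Qed.

Lemma contraction_support_functional x phi : `|x| = 1 -> phi x = 1 ->
  (forall y, `|phi y| <= `|y|) -> support_functionals x phi.
Proof.
move=> x1 phix phi_le; split => //.
  apply/linear_bounded_continuous; exists 1; split; first exact: real1.
  move=> M M1; near=> y; apply: le_trans (phi_le y) _; apply: ltW.
  apply: le_lt_trans M1; near: y.
  apply/nbhs_normP; exists 1 => //= y /=; rewrite sub0r normrN; exact: ltW.
have ub : ubound [set Normc.normc (phi z) | z in [set z : B | `|z| <= 1]] 1.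
  by move=> _ [z z1 <-]; rewrite -lecR; exact: le_trans (phi_le z) z1.
have in1 : [set Normc.normc (phi z) | z in [set z : B | `|z| <= 1]] 1.
  by exists x; rewrite /= ?x1// phix Normc.normc1.
apply/eqP; rewrite eq_le ge_sup//=; last by exists 1.
by apply: ub_le_sup => //; exists 1.
Unshelve. all: by end_near. Qed.

End support_functionals.

(** * Numerical range and radius at the adjoined identity *)

Section numrange_unitization.
Context {R : realType} {A : normedAlgType R}.
Implicit Types (a : A) (l z : R[i]).

Lemma norm_adjoin a l : `|adjoin a l| = `|a| + `|l|.
Proof. by []. Qed.

Lemma norm_adjoined_one : `|adjoined_one : unitization A| = 1.
Proof. by rewrite norm_adjoin normr0 normr1 add0r. Qed.

Lemma amul_adjoined_one a l : amul (adjoin a l) adjoined_one = adjoin a l.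
Proof.
have amulr0 : amul a 0 = 0 by rewrite -(scale0r (0 : A)) amulZr !scale0r.
rewrite [LHS]/(unitization_mul _ _) /unitization_mul /=.
by rewrite amulr0 mulr1 scale1r scaler0 add0r addr0.
Qed.

Lemma numrange_at_adjoined_one a l :
  numrange_at (adjoin a l) adjoined_one = [set z | `|z - l| <= `|a|].
Proof.
rewrite /numrange_at amul_adjoined_one; apply/seteqP; split => z.
  move=> [phi sphi <-] /=; have [_ _ phi1] := sphi.
  (* Since [phi] is 1 at the identity, the displacement from [l] is the value of [phi] at
     [adjoin a 0]. *)
  have -> : adjoin a l = adjoin a 0 + l *: adjoined_one.
    change ((a, l) = (a + l *: 0, 0 + l * 1)).
    by rewrite scaler0 addr0 add0r mulr1.
  rewrite linearD linearZ phi1 /= [l *: _]mulr1 addrK.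
  have := support_functional_le _ _ (adjoin a 0) sphi.
  by rewrite norm_adjoin normr0 addr0.
move=> /= zl; have [phi phi_le phia] := exists_norming_functional a.
(* This factor makes the norming functional take the value [z - l] at [a]. If [a = 0], then [c = 0]
   because [0^-1 = 0], and [zl] forces [z = l]. *)
pose c := (z - l) / `|a|.
have c1 : `|c| <= 1.
  rewrite normf_div normr_id; have [->|a0] := eqVneq a 0.
    by rewrite normr0 invr0 mulr0.
  by rewrite ler_pdivrMr ?normr_gt0// mul1r.
have cphia : c * phi a = z - l.
  rewrite phia; have [a0|a0] := eqVneq a 0; last by rewrite divfK ?normr_eq0.
  by move: zl; rewrite a0 normr0 mulr0 normr_le0 => /eqP.
pose g (u : unitization A) : R[i]^o := c * phi u.1 + u.2.
have g_linear : linear g.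
  move=> k u v; rewrite /g /= linearP /=.
  by rewrite mulrDr [k *: (_ + _)]mulrDr addrACA mulrCA.
pose psi : {linear unitization A -> R[i]^o} := HB.pack g
  (GRing.isLinear.Build R[i] (unitization A) R[i]^o *:%R g g_linear).
exists psi; last by rewrite /= /g /= cphia subrK.
apply: contraction_support_functional; first exact: norm_adjoined_one.
  by rewrite /= /g /= linear0 mulr0 add0r.
move=> [b m]; rewrite norm_adjoin; apply: le_trans (ler_normD _ _) _.
rewrite lerD2r normrM; apply: le_trans (phi_le b).
by rewrite ler_piMl.
Qed.

(** The disk point farthest from 0 lies beyond the centre [l] on the ray from 0, at distance equal
    to the sum of the norms of [a] and [l]. *)
Lemma numradius_at_adjoined_one a l :
  (numradius_at (adjoin a l) adjoined_one)%:C = `|adjoin a l|.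
Proof.
rewrite rnormE; congr (_%:C); rewrite /numradius_at numrange_at_adjoined_one.
have ub : ubound [set Normc.normc z | z in [set z : R[i]^o | `|z - l| <= `|a|]]
    (rnorm (adjoin a l)).
  move=> _ [z /= zl <-]; rewrite -lecR -rnormE norm_adjoin.
  rewrite -[leLHS]/(`|z|) -(subrK l z); apply: le_trans (ler_normD _ _) _.
  by rewrite lerD2r.
have att : [set Normc.normc z | z in [set z : R[i]^o | `|z - l| <= `|a|]]
    (rnorm (adjoin a l)).
  (* The direction of [l]; for [l = 0] the choice 1 is arbitrary among unimodular numbers. *)
  pose w := if l == 0 then 1 else l / `|l|.
  have w1 : `|w| = 1.
    rewrite /w; case: eqVneq => [_|l0]; first exact: normr1.
    by rewrite normf_div normr_id divff// normr_eq0.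
  have lw : `|l| * w = l.
    rewrite /w; case: eqVneq => [->|l0]; first by rewrite normr0 mul0r.
    by rewrite mulrC divfK// normr_eq0.
  exists (`|a| * w + l) => /=; first by rewrite addrK normrM w1 mulr1 normr_id.
  apply: complexI; rewrite -rnormE norm_adjoin -[LHS]/(`|_ + l|).
  by rewrite -[X in _ + X]lw -mulrDl normrM w1 mulr1 ger0_norm// addr_ge0.
apply/eqP; rewrite eq_le ge_sup//=; last by exists (rnorm (adjoin a l)).
by apply: ub_le_sup => //; exists (rnorm (adjoin a l)).
Qed.

End numrange_unitization.

Theorem theorem2p5 (R : realType) (A : normedAlgType R) (hA : non_unital A) :
  [/\ forall a : A,
        closed_convex_hull (numrange a `|` [set 0])
          `<=` numrange_at (adjoin a 0) adjoined_one,
      forall (a : A) (l : R[i]),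
        ((expR 1)^-1)%:C * `|adjoin a l|
          <= (numradius_at (adjoin a l) adjoined_one)%:C
          <= `|adjoin a l|
    & forall a : A,
        ((expR 1)^-1)%:C * `|a|
          <= (numradius_at (adjoin a 0) adjoined_one)%:C
          <= `|a| ].
Proof.
(* As the numerical radius equals the norm, both lower bounds reduce to [1/e <= 1]. *)
have le_e (r : R[i]) : 0 <= r -> ((expR 1)^-1)%:C * r <= r.
  move=> r0; rewrite ler_piMl// -[leRHS]/(1%:C) lecR.
  by rewrite invf_le1 ?expR_gt0// -[leLHS]expR0 ler_expR.
have norm_adjoin0 (a : A) : `|adjoin a 0| = `|a|.
  by rewrite norm_adjoin normr0 addr0.
split=> [a|a l|a]; last 2 first.
- by rewrite numradius_at_adjoined_one lexx andbT le_e.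
- by rewrite numradius_at_adjoined_one norm_adjoin0 lexx andbT le_e.
rewrite numrange_at_adjoined_one; apply: smallest_sub.
  have -> : [set z : R[i]^o | `|z - 0| <= `|a|] = [set z | `|z| <= `|a|].
    by under eq_set do rewrite subr0.
  by split; [exact: closed_disk|exact: convex_disk].
(* A value [phi (amul a x)] is bounded by the norm of [amul a x], hence by that of [a], as [x] is a
   unit vector. *)
move=> z [[x x1 [phi sphi <-]]|->]; last by rewrite /= subr0 normr0.
rewrite /= subr0; apply: le_trans (support_functional_le _ _ _ sphi) _.
by rewrite -[leRHS]mulr1 -x1 ler_norm_amul.
Qed.
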